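(* Let $c>0$ be a given switching cost. Let $u\in\mathbb R^{N\times d}$ be the solution of the quasi-variational inequality $$\min\big(F_i(u),\,u^i-\mathcal M_iu\big)=0,\qquad i\in\mathcal I,$$ and for each $\rho>0$ let $u^\rho\in\mathbb R^{N\times d}$ be the solution of the penalized problem $$F_i(u^{\rho})_l-\rho\sum_{j\neq i}\pi\big(u^{\rho,j}_l-c-u^{\rho,i}_l\big)=0,\qquad i\in\mathcal I,\ l\in\mathcal N.$$ Suppose that there exist positive constants $C_0$ and $\sigma$ such that $0\le u-u^\rho\le C_0\rho^{-\sigma}\ln\rho$ holds for all sufficiently large $\rho$. For $i\in\mathcal I$ define $$\Gamma_i=\{l\in\mathcal N\mid u^i_l=(\mathcal M_iu)_l\},\qquad \Gamma_{\rho,i}=\{l\in\mathcal N\mid |u^{\rho,i}_l-(\mathcal M_iu^\rho)_l|\le C_0\rho^{-\sigma}\ln\rho\}.$$ Then there exists $\rho_0>0$ such that $\Gamma_i=\Gamma_{\rho,i}$ for all $\rho\ge\rho_0$ and all $i\in\mathcal I$.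
   Context: Let $N\ge1$ and $d\ge 2$ be integers, $\mathcal I=\{1,\dots,d\}$, $\mathcal N=\{1,\dots,N\}$. An element $u\in\mathbb R^{N\times d}$ is written $u=(u^1,\dots,u^d)$ with $u^i\in\mathbb R^N$ and entries $u^i_l$. Inequalities, minima and maxima of vectors/matrices are understood elementwise (also when comparing with a scalar), and adding or subtracting a scalar acts on every entry. $F=(F_i)_{i\in\mathcal I}:\mathbb R^{N\times d}\to\mathbb R^{N\times d}$ (with $F_i(u)\in\mathbb R^N$) is a continuous function satisfying the monotonicity condition: there is a constant $\gamma>0$ such that for any $u,v\in\mathbb R^{N\times d}$, $i\in\mathcal I$, $l\in\mathcal N$ with $u^i_l-v^i_l=\max_{j\in\mathcal I,k\in\mathcal N}(u^j_k-v^j_k)\ge 0$, one has $F_i(u)_l-F_i(v)_l\ge\gamma(u^i_l-v^i_l)$. $\mathcal M_iu:=\max_{j\ne i}(u^j-c)\in\mathbb R^N$. The penalty function $\pi:\mathbb R\to\mathbb R$ is a continuous non-decreasing function with $\pi|_{(-\infty,0]}=0$ and $\pi|_{(0,\infty)}>0$. The quasi-variational inequality (for $c>0$) and the penalized problem (for $\rho\ge 0$, $c\ge0$) each have a unique solution. *)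

(* Defs.v *)
From HB Require Import structures.
From mathcomp Require Import all_boot all_order all_algebra.
From mathcomp Require Import all_classical all_reals all_analysis.

Set Implicit Arguments.
Unset Strict Implicit.
Unset Printing Implicit Defensive.

Import Order.TTheory GRing.Theory Num.Theory.
Import numFieldNormedType.Exports.

Local Open Scope classical_set_scope.
Local Open Scope ring_scope.

(* Conventions: a point u of R^(N x d) is a matrix u : 'M[R]_(N, d) and the  *)
(* entry u^i_l is [u l i]; likewise F_i(u)_l is [F u l i].                    *)

(* Maximum of f over P: the iterated maximum is taken in \bar R, where it has *)
(* a neutral element, and is finite as soon as P is nonempty (see fmaxP).     *)
Definition fmax (R : realType) (I : finType) (P : pred I) (f : I -> R) : R :=
  fine (\big[maxe/-oo%E]_(i | P i) (f i)%:E).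

Lemma fmaxP (R : realType) (I : finType) (P : pred I) (f : I -> R) :
  (exists i, P i) ->
  (forall i, P i -> f i <= fmax P f) /\ (exists2 i, P i & fmax P f = f i).
Proof.
move=> [i0 Pi0].
have [i Pi E] : exists2 i, P i & (\big[maxe/-oo%E]_(i | P i) (f i)%:E = (f i)%:E)%E.
  have [i Pi ->] := @eq_bigmax _ _ _ -oo%E i0 P (fun i => (f i)%:E) Pi0
    (fun j _ => leNye _).
  by exists i.
rewrite /fmax E /=; split; last by exists i.
by move=> j Pj; rewrite -lee_fin -E; exact: le_bigmax_cond.
Qed.

Section Definitions.
Context (R : realType) (N d : nat).
Implicit Types (F : 'M[R]_(N, d) -> 'M[R]_(N, d)) (u v : 'M[R]_(N, d)).
Implicit Types (c rho eps : R) (pi : R -> R) (i : 'I_d) (l : 'I_N).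

Definition monotonicity_condition F : Prop :=
  exists2 gamma : R, 0 < gamma &
    forall u v i l,
      u l i - v l i = fmax xpredT (fun jk : 'I_d * 'I_N =>
                                     u jk.2 jk.1 - v jk.2 jk.1) ->
      0 <= u l i - v l i ->
      gamma * (u l i - v l i) <= F u l i - F v l i.

(* [switching_op c i u l] is (M_i u)_l. *)
Definition switching_op c i u l : R :=
  fmax (fun j : 'I_d => j != i) (fun j => u l j - c).

Definition penalty_function pi : Prop :=
  [/\ continuous pi,
      {homo pi : x y / x <= y},
      forall x, x <= 0 -> pi x = 0
    & forall x, 0 < x -> 0 < pi x].

Definition qvi_solution F c u : Prop :=
  forall i l, Num.min (F u l i) (u l i - switching_op c i u l) = 0.

Definition penalized_solution F pi c rho v : Prop :=
  forall i l,
    F v l i - rho * \sum_(j < d | j != i) pi (v l j - c - v l i) = 0.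

Definition contact_set c u i : set 'I_N :=
  [set l | u l i = switching_op c i u l].

Definition approx_contact_set c eps v i : set 'I_N :=
  [set l | `|v l i - switching_op c i v l| <= eps].

End Definitions.

(* Main.v *)
(** Both [u] and [M_i u] exceed their penalized counterparts by an amount in
    [[0, eps]], where [eps := C0 rho^-sigma ln rho]. Hence the obstacle gaps
    [u - M_i u] and [u^rho - M_i u^rho] differ by at most [eps], so contact
    for [u] forces approximate contact for [u^rho]. Conversely, approximate
    contact for [u^rho] gives [|u - M_i u| <= 2 eps], and since [eps]
    vanishes as [rho] tends to infinity while the finitely many nonzero gaps
    of [u] are bounded away from [0], this gap is [0] once [rho] is large. *)
Require Import Defs.
From HB Require Import structures.
From mathcomp Require Import all_boot all_order all_algebra.
From mathcomp Require Import all_classical all_reals all_analysis.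
From mathcomp Require Import lra.

Set Implicit Arguments.
Unset Strict Implicit.
Unset Printing Implicit Defensive.

Import Order.TTheory GRing.Theory Num.Theory.
Import numFieldNormedType.Exports.

Local Open Scope classical_set_scope.
Local Open Scope ring_scope.

(** With [y = x^(s/2)] the function equals [(2/s) ln y / y^2]; [ln y < y] bounds it by [(2/s) / y],
    and [y] tends to infinity. *)
Lemma cvg_powRN_ln (R : realType) (s : R) : 0 < s ->
  x `^ (- s) * ln x @[x --> +oo] --> 0.
Proof.
move=> s0; have h0 : 0 < s / 2 by rewrite divr_gt0.
apply/cvgrPdist_lt => e e0; near=> x.
have x1 : 1 < x by near: x; apply: nbhs_pinfty_gt; rewrite num_real.
have x0 : 0 < x by exact: lt_trans x1.
rewrite sub0r normrN ger0_norm; last by rewrite mulr_ge0 ?powR_ge0// ln_ge0// ltW.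
set y := x `^ (s / 2).
have y0 : 0 < y by exact: powR_gt0.
have lnxE : ln x = (s / 2)^-1 * ln y by rewrite ln_powR mulKf// gt_eqF.
have xsE : x `^ (- s) = (y * y)^-1.
  by rewrite powRN /y -powRD -?splitr// gt_eqF// implybT.
have K0 : 0 < (e * (s / 2))^-1 by rewrite invr_gt0 mulr_gt0.
(* Beyond this threshold [(2/s) / y < e]. Writing it as a power with exponent [s/2] reduces the
   claim to a lower bound on [x]. *)
have yK : (e * (s / 2))^-1 < y.
  have -> : (e * (s / 2))^-1 = (e * (s / 2))^-1 `^ (s / 2)^-1 `^ (s / 2).
    by rewrite -powRrM mulVf ?gt_eqF// powRr1// ltW.
  by apply: gt0_ltr_powR; rewrite ?nnegrE ?powR_ge0 ?ltW//.
have lny := ln_sublinear y0.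
rewrite xsE lnxE invfM -mulrA ltr_pdivrMl// ltr_pdivrMl//.
rewrite mulrCA ltr_pdivrMl//; apply: (lt_trans lny).
by move: yK; rewrite -[_^-1]mul1r ltr_pdivrMr ?mulr_gt0//; nra.
Unshelve. all: by end_near. Qed.

(** A maximizer for either matrix competes in the maximum for the other, which gives both bounds;
    [2 <= d] makes the index set nonempty. *)
Lemma switching_op_dist (R : realType) (N d : nat) (c eps : R)
    (u v : 'M[R]_(N, d)) (i : 'I_d) (l : 'I_N) : (2 <= d)%N ->
  (forall j, 0 <= u l j - v l j <= eps) ->
  0 <= switching_op c i u l - switching_op c i v l <= eps.
Proof.
move=> d2 uv.
have [j0 j0i] : exists j : 'I_d, j != i.
  have : (0 < #|predC1 i|)%N by rewrite cardC1 card_ord -ltnS prednK// ltnW.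
  by case/card_gt0P => j ji; exists j.
have ex : exists j : 'I_d, j != i by exists j0.
have [ule [j ji uE]] := fmaxP (fun j => u l j - c) ex.
have [vle [k ki vE]] := fmaxP (fun j => v l j - c) ex.
have /= := ule _ ki; have /= := vle _ ji; rewrite /switching_op uE vE.
by have := uv j; have := uv k; lra.
Qed.

Theorem theorem3p10 (R : realType) (N d : nat) (hN : (1 <= N)%N) (hd : (2 <= d)%N)
    (F : 'M[R]_(N, d) -> 'M[R]_(N, d))
    (F_continuous : continuous F) (F_monotone : monotonicity_condition F)
    (pi : R -> R) (hpi : penalty_function pi)
    (c : R) (hc : 0 < c)
    (u : 'M[R]_(N, d)) (hu : qvi_solution F c u)
    (urho : R -> 'M[R]_(N, d))
    (hurho : forall rho : R, 0 < rho -> penalized_solution F pi c rho (urho rho))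
    (C0 sigma : R) (hC0 : 0 < C0) (hsigma : 0 < sigma)
    (herr : \forall rho \near +oo, forall (i : 'I_d) (l : 'I_N),
       0 <= u l i - urho rho l i <= C0 * rho `^ (- sigma) * ln rho) :
  exists2 rho0 : R, 0 < rho0 &
    forall rho : R, rho0 <= rho -> forall i : 'I_d,
      contact_set c u i =
      approx_contact_set c (C0 * rho `^ (- sigma) * ln rho) (urho rho) i.
Proof.
pose gap i l := u l i - switching_op c i u l.
pose eps rho := C0 * rho `^ (- sigma) * ln rho.
have eps_cvg : eps rho @[rho --> +oo] --> 0.
  rewrite (_ : eps = fun rho => C0 * (rho `^ (- sigma) * ln rho)); last first.
    by apply/funext => rho; rewrite /eps mulrA.
  by rewrite -[X in _ --> X](mulr0 C0); apply: cvgMr; exact: cvg_powRN_ln.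
have eps_small : \forall rho \near +oo, forall il : 'I_d * 'I_N,
    gap il.1 il.2 != 0 -> 2 * eps rho < `|gap il.1 il.2|.
  (* There are finitely many pairs, so one threshold serves them all; a zero gap imposes nothing. *)
  apply: filter_forall => -[i l] /=; have [->|gap0] := eqVneq (gap i l) 0.
    by apply: nearW.
  have g2 : 0 < `|gap i l| / 2 by rewrite divr_gt0// normr_gt0.
  by apply: filterS (cvgr_lt _ eps_cvg _ g2) => rho erho _; lra.
have : \forall rho \near +oo, forall i,
    contact_set c u i = approx_contact_set c (eps rho) (urho rho) i.
  apply: filterS2 herr eps_small => rho err small i.
  apply/seteqP; split => l; rewrite /contact_set /approx_contact_set /=.
    have := switching_op_dist c i hd (err^~ l); have := err i l.
    by rewrite -/(eps rho) ler_norml => ? ? ?; lra.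
  have := switching_op_dist c i hd (err^~ l); have := err i l.
  rewrite -/(eps rho) => ? ? v_near; apply/eqP; rewrite -subr_eq0.
  (* Approximate contact allows a gap of [eps rho], and passing from [urho rho] to [u] adds at most
     another. *)
  apply/negPn/negP => /(small (i, l)); apply/negP; rewrite -leNgt /gap /=.
  by move: v_near; rewrite !ler_norml; lra.
(* The property holds on the open ray above [M], which may be negative; [|M| + 1] is positive and
   strictly above [M]. *)
case=> M [_ HM]; exists (`|M| + 1) => [|rho Mrho]; first by rewrite ltr_wpDl.
by apply: HM; have := ler_norm M; lra.
Qed.
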